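(* For any $R$-module $M$ which is finitely presented or finitely copresented, we have $M^{\star\star}=M$.
   Context: We work in homotopy type theory with univalent universes and propositional truncation (neither excluded middle nor the axiom of choice is assumed). ''Merely'', ''there exists'' and disjunction refer to propositional truncation; a map is surjective if its fibers are merely inhabited. Fix a commutative ring $R$. A finitely presented $R$-algebra is one merely of the form $R[X_1,\dots,X_n]/(P_1,\dots,P_l)$; for such $A$, $\mathrm{Spec}(A)$ is the type of $R$-algebra homomorphisms $A\to R$, and for $a:A$, $x:\mathrm{Spec}(A)$ one writes $a(x)=x(a)$. A Zariski-cover of $\mathrm{Spec}(A)$ is a finite family of subtypes $U_i=\{x\mid f_i(x)\text{ invertible}\}$ with $f_1,\dots,f_n:A$ generating the unit ideal. Axioms: (Locality) $R$ is local: $1\neq 0$, and if $x+y$ is invertible then $x$ or $y$ is invertible. (Duality) For every finitely presented $R$-algebra $A$ the map $A\to(\mathrm{Spec}(A)\to R)$, $a\mapsto(\varphi\mapsto\varphi(a))$ is an isomorphism of $R$-algebras. (Zariski-local choice) For every finitely presented $R$-algebra $A$ and family $B$ of merely inhabited types over $\mathrm{Spec}(A)$, there merely exist a Zariski-cover $U_1,\dots,U_n$ of $\mathrm{Spec}(A)$ and dependent functions $s_i:(x:U_i)\to B(x)$. For an $R$-module $M$, $M^\star=\mathrm{Hom}_R(M,R)$ denotes its dual. Equality of $R$-modules is identification as $R$-modules, i.e. (by univalence) $R$-linear isomorphism. An $R$-module is finitely presented if it is merely the cokernel of a linear map $R^a\to R^b$, and finitely copresented if it is merely the kernel of a linear map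 $R^n\to R^m$. *)

(* Defs.v *)
(* The structures of [ssralg] cannot be used for R: they all carry a choiceType,
   hence decidable equality, which contradicts duality for a nontrivial ring. *)
From Stdlib Require Import Ring_theory FunctionalExtensionality ProofIrrelevance.
From HB Require Import structures.
From mathcomp Require Import all_boot.

Set Implicit Arguments.
Unset Strict Implicit.
Unset Printing Implicit Defensive.
#[local] Obligation Tactic := idtac.
#[local] Unset Program Cases.

(* Conventions.  Types play the role of sets, [Prop] that of the propositions of
   type theory, and [exists], [\/], [inhabited] are propositional truncations.
   Data, such as a section in local choice or the final isomorphism, is stated
   in [Type]. *)

(* A theorem of homotopy type theory (from a contractible type one can extract
   its centre) that Rocq's elimination restriction on [Prop] does not provide. *)
Definition unique_choice : Type :=
  forall (T : Type) (P : T -> Prop), (exists! x, P x) -> {x : T | P x}.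

Definition surj (X Y : Type) (f : X -> Y) : Prop := forall y, exists x, f x = y.

(* ** Commutative rings and algebras *)

Declare Scope cring_scope.
Delimit Scope cring_scope with CR.

Record cring := CRing {
  cring_sort :> Type;
  czero : cring_sort;
  cone : cring_sort;
  cadd : cring_sort -> cring_sort -> cring_sort;
  cmul : cring_sort -> cring_sort -> cring_sort;
  copp : cring_sort -> cring_sort;
  cring_theory :
    ring_theory czero cone cadd cmul (fun x y => cadd x (copp y)) copp eq
}.
Arguments czero {c}.
Arguments cone {c}.
Bind Scope cring_scope with cring_sort.
Local Open Scope cring_scope.
Notation "0" := czero : cring_scope.
Notation "1" := cone : cring_scope.
Notation "x + y" := (cadd x y) : cring_scope.
Notation "x * y" := (cmul x y) : cring_scope.
Notation "- x" := (copp x) : cring_scope.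
Notation "\csum_ ( i < n ) F" := (\big[@cadd _/czero]_(i < n) F)
  (at level 41, F at level 41, i, n at level 50) : cring_scope.

Lemma caddA (R : cring) : associative (@cadd R).
Proof. exact: Radd_assoc (cring_theory R). Qed.
Lemma caddC (R : cring) : commutative (@cadd R).
Proof. exact: Radd_comm (cring_theory R). Qed.
Lemma cadd0r (R : cring) : left_id 0 (@cadd R).
Proof. exact: Radd_0_l (cring_theory R). Qed.
Lemma cmulA (R : cring) : associative (@cmul R).
Proof. exact: Rmul_assoc (cring_theory R). Qed.
Lemma cmulC (R : cring) : commutative (@cmul R).
Proof. exact: Rmul_comm (cring_theory R). Qed.
Lemma cmul1r (R : cring) : left_id 1 (@cmul R).
Proof. exact: Rmul_1_l (cring_theory R). Qed.
Lemma cmulDl (R : cring) : left_distributive (@cmul R) (@cadd R).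
Proof. exact: Rdistr_l (cring_theory R). Qed.
Lemma cmulDr (R : cring) : right_distributive (@cmul R) (@cadd R).
Proof. by move=> x y z; rewrite cmulC cmulDl ![_ * x]cmulC. Qed.
Lemma caddrN (R : cring) (x : R) : x + - x = 0.
Proof. exact: Ropp_def (cring_theory R) x. Qed.
Lemma caddNr (R : cring) (x : R) : - x + x = 0.
Proof. by rewrite caddC caddrN. Qed.
Lemma caddr0 (R : cring) : right_id 0 (@cadd R).
Proof. by move=> x; rewrite caddC cadd0r. Qed.
Lemma caddI (R : cring) (x y z : R) : x + y = x + z -> y = z.
Proof.
by move=> e; rewrite -[y]cadd0r -(caddNr x) -caddA e caddA caddNr cadd0r.
Qed.
Lemma cmulr0 (R : cring) : right_zero 0 (@cmul R).
Proof. by move=> x; apply: (@caddI _ (x * 0)); rewrite -cmulDr !caddr0. Qed.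
Lemma cmul0r (R : cring) : left_zero 0 (@cmul R).
Proof. by move=> x; rewrite cmulC cmulr0. Qed.
Lemma cmulr1 (R : cring) : right_id 1 (@cmul R).
Proof. by move=> x; rewrite cmulC cmul1r. Qed.
Lemma coppr0 (R : cring) : - (0 : R) = 0.
Proof. by rewrite -[RHS](caddrN 0) cadd0r. Qed.
Lemma coppD (R : cring) (x y : R) : - (x + y) = - x + - y.
Proof.
apply: (@caddI _ (x + y)); rewrite caddrN (caddC x) -caddA (caddA x) caddrN.
by rewrite cadd0r caddrN.
Qed.
Lemma cmulrN (R : cring) (x y : R) : x * - y = - (x * y).
Proof. by apply: (@caddI _ (x * y)); rewrite -cmulDr !caddrN cmulr0. Qed.

HB.instance Definition _ (R : cring) :=
  Monoid.isComLaw.Build R 0 (@cadd R) (@caddA R) (@caddC R) (@cadd0r R).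
HB.instance Definition _ (R : cring) :=
  Monoid.isComLaw.Build R 1 (@cmul R) (@cmulA R) (@cmulC R) (@cmul1r R).
HB.instance Definition _ (R : cring) :=
  Monoid.isMulLaw.Build R 0 (@cmul R) (@cmul0r R) (@cmulr0 R).
HB.instance Definition _ (R : cring) :=
  Monoid.isAddLaw.Build R (@cmul R) (@cadd R) (@cmulDl R) (@cmulDr R).

Definition invertible (R : cring) (x : R) : Prop := exists y, x * y = 1.

Record ring_hom (A B : cring) := RingHom {
  ring_hom_fun :> A -> B;
  ring_hom1 : ring_hom_fun 1 = 1;
  ring_homD : forall x y, ring_hom_fun (x + y) = ring_hom_fun x + ring_hom_fun y;
  ring_homM : forall x y, ring_hom_fun (x * y) = ring_hom_fun x * ring_hom_fun y
}.

Definition ring_id (A : cring) : ring_hom A A :=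
  @RingHom A A id erefl (fun _ _ => erefl) (fun _ _ => erefl).

Program Definition ring_comp (A B C : cring) (g : ring_hom B C)
    (f : ring_hom A B) : ring_hom A C := @RingHom A C (fun x => g (f x)) _ _ _.
Next Obligation. by move=> A B C g f /=; rewrite !ring_hom1. Qed.
Next Obligation. by move=> A B C g f x y /=; rewrite !ring_homD. Qed.
Next Obligation. by move=> A B C g f x y /=; rewrite !ring_homM. Qed.

Record algebra (R : cring) := Algebra {
  alg_ring :> cring;
  alg_map : ring_hom R alg_ring
}.
Arguments alg_map {R} a.

Record alg_hom (R : cring) (A B : algebra R) := AlgHom {
  alg_hom_fun :> ring_hom A B;
  alg_homC : forall r, alg_hom_fun (alg_map A r) = alg_map B r
}.

Definition self_alg (R : cring) : algebra R := Algebra (ring_id R).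

(* ** Polynomials: finitely supported coefficient sequences *)

Definition poly (R : cring) : Type :=
  {c : nat -> R | exists d, forall k, d <= k -> c k = 0}.

Definition coef (R : cring) (p : poly R) : nat -> R := proj1_sig p.

Lemma poly_ext (R : cring) (p q : poly R) : coef p =1 coef q -> p = q.
Proof.
case: p q => [p hp] [q hq] /= e; have {}e : p = q.
  exact: functional_extensionality.
by subst q; congr exist; apply: proof_irrelevance.
Qed.

Program Definition polyC (R : cring) (a : R) : poly R :=
  exist _ (fun k => if k is 0%N then a else 0) _.
Next Obligation. by move=> R a; exists 1%N => -[]. Qed.

Program Definition poly_add (R : cring) (p q : poly R) : poly R :=
  exist _ (fun k => coef p k + coef q k) _.
Next Obligation.
move=> R [p [d hp]] [q [e hq]]; exists (maxn d e) => k.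
by rewrite geq_max => /andP[dk ek] /=; rewrite hp ?hq ?cadd0r.
Qed.

Program Definition poly_opp (R : cring) (p : poly R) : poly R :=
  exist _ (fun k => - coef p k) _.
Next Obligation.
by move=> R [p [d hp]]; exists d => k dk /=; rewrite hp ?coppr0.
Qed.

Program Definition poly_mul (R : cring) (p q : poly R) : poly R :=
  exist _ (fun k => \csum_(i < k.+1) (coef p i * coef q (k - i)%N)) _.
Next Obligation.
move=> R [p [d hp]] [q [e hq]]; exists (d + e)%N => k dek /=.
apply: big1 => i _; case: (leqP d i) => [di | id].
  by rewrite hp ?cmul0r.
rewrite hq ?cmulr0 //; rewrite leq_subRL; last by rewrite -ltnS.
by apply: leq_trans dek; rewrite leq_add2r ltnW.
Qed.

Lemma coef_mulE (R : cring) (p q : poly R) k :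
  coef (poly_mul p q) k = \csum_(i < k.+1) (coef p i * coef q (k - i)%N).
Proof. by []. Qed.

Lemma coef_mul_rev (R : cring) (p q : poly R) k :
  coef (poly_mul p q) k = \csum_(i < k.+1) (coef p (k - i)%N * coef q i).
Proof.
rewrite coef_mulE (reindex_inj rev_ord_inj) /=.
by apply: eq_bigr => j _; rewrite (sub_ordK j).
Qed.

Lemma poly_mulC (R : cring) : commutative (@poly_mul R).
Proof.
move=> p q; apply: poly_ext => k; rewrite coef_mulE coef_mul_rev.
by apply: eq_bigr => i _; rewrite cmulC.
Qed.

Lemma poly_mulA (R : cring) : associative (@poly_mul R).
Proof.
move=> p q r; apply: poly_ext => i; rewrite coef_mulE coef_mul_rev.
pose coef3 j k := coef p j * (coef q (i - j - k)%N * coef r k).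
transitivity (\big[@cadd R/0]_(j < i.+1)
  \big[@cadd R/0]_(k < i.+1 | (k <= i - j)%N) coef3 j k).
  apply: eq_bigr => j _; rewrite coef_mul_rev big_distrr /=.
  by rewrite (big_ord_narrow_leq (leq_subr _ _)).
rewrite (exchange_big_dep predT) //; apply: eq_bigr => k _.
transitivity (\big[@cadd R/0]_(j < i.+1 | (j <= i - k)%N) coef3 j k).
  apply: eq_bigl => j /=; rewrite -ltnS -(ltnS j) -!subSn ?leq_ord //.
  by rewrite -subn_gt0 -(subn_gt0 j) -!subnDA addnC.
rewrite (big_ord_narrow_leq (leq_subr _ _)) coef_mulE big_distrl /=.
by apply: eq_bigr => j _; rewrite /coef3 -!subnDA addnC cmulA.
Qed.

Lemma polyC_mul (R : cring) (a : R) (p : poly R) k :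
  coef (poly_mul (polyC a) p) k = a * coef p k.
Proof.
rewrite coef_mulE big_ord_recl subn0 big1 ?caddr0 //= => i _.
by rewrite cmul0r.
Qed.

Lemma poly_ring_theory (R : cring) :
  ring_theory (polyC (0 : R)) (polyC 1) (@poly_add R) (@poly_mul R)
    (fun p q => poly_add p (poly_opp q)) (@poly_opp R) eq.
Proof.
split=> //.
- by move=> p; apply: poly_ext => -[|k] /=; rewrite cadd0r.
- by move=> p q; apply: poly_ext => k /=; rewrite caddC.
- by move=> p q r; apply: poly_ext => k /=; rewrite caddA.
- by move=> p; apply: poly_ext => k; rewrite polyC_mul cmul1r.
- exact: poly_mulC.
- exact: poly_mulA.
- move=> p q r; apply: poly_ext => k; rewrite coef_mulE /= -big_split /=.
  by apply: eq_bigr => i _; rewrite cmulDl.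
- by move=> p; apply: poly_ext => -[|k] /=; rewrite caddrN.
Qed.

Definition poly_ring (R : cring) : cring := CRing (poly_ring_theory R).

Program Definition polyC_hom (R : cring) : ring_hom R (poly_ring R) :=
  @RingHom R (poly_ring R) (@polyC R) _ _ _.
Next Obligation. by []. Qed.
Next Obligation.
by move=> R x y; apply: poly_ext => -[|k] //=; rewrite cadd0r.
Qed.
Next Obligation.
by move=> R x y; apply: poly_ext => -[|k]; rewrite polyC_mul //= cmulr0.
Qed.

Definition poly_alg (R : cring) (A : algebra R) : algebra R :=
  Algebra (ring_comp (polyC_hom A) (alg_map A)).

(* [mpoly_alg R n] is R[X_1, ..., X_n], as an iterated polynomial algebra. *)
Fixpoint mpoly_alg (R : cring) (n : nat) : algebra R :=
  if n is n'.+1 then poly_alg (mpoly_alg R n') else self_alg R.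

Definition in_ideal (A : cring) (l : nat) (P : 'I_l -> A) (a : A) : Prop :=
  exists q : 'I_l -> A, a = \csum_(i < l) (q i * P i).

(* A is a quotient R[X_1, ..., X_n] / (P_1, ..., P_l): the target of a surjective
   homomorphism whose kernel is the ideal generated by the P_i. *)
Definition fin_presented_alg (R : cring) (A : algebra R) : Prop :=
  exists (n l : nat) (P : 'I_l -> mpoly_alg R n)
         (pi : alg_hom (mpoly_alg R n) A),
    surj pi /\ forall p, pi p = 0 <-> in_ideal P p.

(* ** The axioms on the base ring *)

Definition Spec (R : cring) (A : algebra R) : Type := alg_hom A (self_alg R).

Definition Spec_eval (R : cring) (A : algebra R) (a : A) : Spec A -> R :=
  fun x => x a.

Definition locality (R : cring) : Prop :=
  (1 : R) <> 0 /\
  forall x y : R, invertible (x + y) -> invertible x \/ invertible y.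

(* [Spec_eval] is a homomorphism for the pointwise structure on Spec A -> R. *)
Definition duality (R : cring) : Prop :=
  forall A : algebra R, fin_presented_alg A -> bijective (@Spec_eval R A).

Definition basic_open (R : cring) (A : algebra R) (f : A) : Type :=
  {x : Spec A | invertible (Spec_eval f x)}.

Definition zariski_local_choice (R : cring) : Prop :=
  forall A : algebra R, fin_presented_alg A ->
  forall B : Spec A -> Type, (forall x, inhabited (B x)) ->
  exists (n : nat) (f : 'I_n -> A),
    in_ideal f 1 /\
    inhabited (forall (i : 'I_n) (x : basic_open (f i)), B (proj1_sig x)).

(* ** Modules *)

Record module (R : cring) := Module {
  mod_sort :> Type;
  mzero : mod_sort;
  madd : mod_sort -> mod_sort -> mod_sort;
  mopp : mod_sort -> mod_sort;
  mscale : R -> mod_sort -> mod_sort;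
  maddA : associative madd;
  maddC : commutative madd;
  madd0r : left_id mzero madd;
  maddNr : left_inverse mzero mopp madd;
  mscaleA : forall a b x, mscale a (mscale b x) = mscale (a * b) x;
  mscale1r : forall x, mscale 1 x = x;
  mscaleDr : forall a x y, mscale a (madd x y) = madd (mscale a x) (mscale a y);
  mscaleDl : forall a b x, mscale (a + b) x = madd (mscale a x) (mscale b x)
}.
Arguments mzero {R m}.

Record linear_map (R : cring) (M N : module R) := LinearMap {
  linear_fun :> M -> N;
  linear_mapD : forall x y,
    linear_fun (madd x y) = madd (linear_fun x) (linear_fun y);
  linear_mapZ : forall a x, linear_fun (mscale a x) = mscale a (linear_fun x)
}.

Lemma linear_ext (R : cring) (M N : module R) (f g : linear_map M N) :
  f =1 g -> f = g.
Proof.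
case: f g => [f fD fZ] [g gD gZ] /= e; have {}e : f = g.
  exact: functional_extensionality.
by subst g; congr LinearMap; apply: proof_irrelevance.
Qed.

Record linear_iso (R : cring) (M N : module R) := LinearIso {
  iso_to : linear_map M N;
  iso_from : linear_map N M;
  iso_toK : cancel iso_to iso_from;
  iso_fromK : cancel iso_from iso_to
}.

Program Definition self_mod (R : cring) : module R :=
  @Module R R 0 (@cadd R) (@copp R) (@cmul R)
    (@caddA R) (@caddC R) (@cadd0r R) (@caddNr R) _ (@cmul1r R) _ _.
Next Obligation. by move=> R a b x; rewrite cmulA. Qed.
Next Obligation. by move=> R a x y; rewrite cmulDr. Qed.
Next Obligation. by move=> R a b x; rewrite cmulDl. Qed.

Program Definition free_mod (R : cring) (n : nat) : module R :=
  @Module R ('I_n -> R) (fun _ => 0) (fun u v i => u i + v i)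
    (fun u i => - u i) (fun a u i => a * u i) _ _ _ _ _ _ _ _.
Next Obligation. by move=> R n u v w; apply: functional_extensionality => i; rewrite caddA. Qed.
Next Obligation. by move=> R n u v; apply: functional_extensionality => i; rewrite caddC. Qed.
Next Obligation. by move=> R n u; apply: functional_extensionality => i; rewrite cadd0r. Qed.
Next Obligation. by move=> R n u; apply: functional_extensionality => i; rewrite caddNr. Qed.
Next Obligation. by move=> R n a b u; apply: functional_extensionality => i; rewrite cmulA. Qed.
Next Obligation. by move=> R n u; apply: functional_extensionality => i; rewrite cmul1r. Qed.
Next Obligation. by move=> R n a u v; apply: functional_extensionality => i; rewrite cmulDr. Qed.
Next Obligation. by move=> R n a b u; apply: functional_extensionality => i; rewrite cmulDl. Qed.

Program Definition dual_zero (R : cring) (M : module R) :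
    linear_map M (self_mod R) := @LinearMap R M (self_mod R) (fun _ => 0) _ _.
Next Obligation. by move=> R M x y /=; rewrite cadd0r. Qed.
Next Obligation. by move=> R M a x /=; rewrite cmulr0. Qed.

Program Definition dual_add (R : cring) (M : module R)
    (f g : linear_map M (self_mod R)) : linear_map M (self_mod R) :=
  @LinearMap R M (self_mod R) (fun x => (f x : R) + g x) _ _.
Next Obligation.
move=> R M f g x y /=; rewrite !linear_mapD /= -!caddA; congr cadd.
by rewrite caddC -caddA; congr cadd; rewrite caddC.
Qed.
Next Obligation. by move=> R M f g a x /=; rewrite !linear_mapZ /= cmulDr. Qed.

Program Definition dual_opp (R : cring) (M : module R)
    (f : linear_map M (self_mod R)) : linear_map M (self_mod R) :=
  @LinearMap R M (self_mod R) (fun x => - (f x : R)) _ _.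
Next Obligation. by move=> R M f x y /=; rewrite linear_mapD /= coppD. Qed.
Next Obligation. by move=> R M f a x /=; rewrite linear_mapZ /= cmulrN. Qed.

Program Definition dual_scale (R : cring) (M : module R) (a : R)
    (f : linear_map M (self_mod R)) : linear_map M (self_mod R) :=
  @LinearMap R M (self_mod R) (fun x => a * (f x : R)) _ _.
Next Obligation. by move=> R M a f x y /=; rewrite linear_mapD /= cmulDr. Qed.
Next Obligation.
by move=> R M a f b x /=; rewrite linear_mapZ /= !cmulA (cmulC a).
Qed.

Program Definition dual (R : cring) (M : module R) : module R :=
  @Module R (linear_map M (self_mod R)) (dual_zero M) (@dual_add R M)
    (@dual_opp R M) (@dual_scale R M) _ _ _ _ _ _ _ _.
Next Obligation. by move=> R M f g h; apply: linear_ext => x /=; rewrite caddA. Qed.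
Next Obligation. by move=> R M f g; apply: linear_ext => x /=; rewrite caddC. Qed.
Next Obligation. by move=> R M f; apply: linear_ext => x /=; rewrite cadd0r. Qed.
Next Obligation. by move=> R M f; apply: linear_ext => x /=; rewrite caddNr. Qed.
Next Obligation. by move=> R M a b f; apply: linear_ext => x /=; rewrite cmulA. Qed.
Next Obligation. by move=> R M f; apply: linear_ext => x /=; rewrite cmul1r. Qed.
Next Obligation. by move=> R M a f g; apply: linear_ext => x /=; rewrite cmulDr. Qed.
Next Obligation. by move=> R M a b f; apply: linear_ext => x /=; rewrite cmulDl. Qed.

Definition is_cokernel (R : cring) (L M N : module R)
    (f : linear_map L M) (p : linear_map M N) : Prop :=
  surj p /\ forall y, p y = mzero <-> exists x, f x = y.

Definition is_kernel (R : cring) (L M N : module R)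
    (f : linear_map M N) (i : linear_map L M) : Prop :=
  injective i /\ forall y, f y = mzero <-> exists x, i x = y.

Definition fin_presented (R : cring) (M : module R) : Prop :=
  exists (a b : nat) (f : linear_map (free_mod R a) (free_mod R b))
         (p : linear_map (free_mod R b) M), is_cokernel f p.

Definition fin_copresented (R : cring) (M : module R) : Prop :=
  exists (n m : nat) (f : linear_map (free_mod R n) (free_mod R m))
         (i : linear_map M (free_mod R n)), is_kernel f i.

(* Main.v *)
From Stdlib Require Import Ring FunctionalExtensionality.
From Stdlib Require Import PropExtensionality ProofIrrelevance.
From mathcomp Require Import all_boot.
Require Import Defs.

Set Implicit Arguments.
Unset Strict Implicit.
Unset Printing Implicit Defensive.

Local Open Scope cring_scope.

(** Everything follows from one fact about the kernel L of a matrix f from R^n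
    to R^m, seen inside R^n through i:
    - every linear form on L is the restriction of a linear form on R^n
      ([kernel_form_extends]);
    - a linear form on R^n that vanishes on L is a linear combination of the
      rows of f ([kernel_annihilator]).
    In other words the dual of L is the cokernel of the transpose of f.

    Both parts come from duality.  The points of L are the common zeros of the
    linear polynomials l_j given by the rows of f, hence the points of the
    spectrum of R[X]/(l_j).  Duality for such quotients says that every function
    on the zeros is the value of a polynomial ([function_polynomial]) and that
    a polynomial vanishing at all zeros lies in the ideal
    ([vanishing_in_ideal]).

    For the second part, a linear form vanishing on L is a combination of the
    l_j with polynomial coefficients; comparing linear parts replaces these
    coefficients by their values at 0.  For the first part, a linear form on L
    is the function of some polynomial p.  By homogeneity p(TX) - T p(X)
    vanishes on L x R, so it lies in the ideal of R[X, T] generated by the l_j;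
    the coefficient of T shows that p agrees on L with its own linear part.

    Reflexivity is then formal.  If M is the kernel of f, an element F of the
    bidual is determined by its values v_k on the coordinate forms, because
    these generate the dual; linear relations between the coordinates on M
    are respected by F, so v is killed by f and is a point of M.  If M is the
    cokernel of f, its dual is the kernel of the transpose of f; a form on the
    dual extends to R^b, hence is evaluation at an element of M, and an element
    of M killed by all forms is represented by a vector orthogonal to that
    kernel, hence in the image of f.  So the canonical map from M to its bidual
    is injective and surjective, and unique choice inverts it.

    The quotient rings, the evaluation of polynomials and the inverse are all
    built by unique choice from data that is merely existing but unique. *)

(** * Homomorphisms and ideals *)

Section RingHom.
Variables (A B : cring) (f : ring_hom A B).

Lemma ring_hom0 : f 0 = 0.
Proof. by apply: (@caddI _ (f 0)); rewrite -ring_homD !caddr0. Qed.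

Lemma ring_homN x : f (- x) = - f x.
Proof. by apply: (@caddI _ (f x)); rewrite -ring_homD !caddrN ring_hom0. Qed.

Lemma ring_hom_sum n (F : 'I_n -> A) :
  f (\csum_(i < n) F i) = \csum_(i < n) f (F i).
Proof. by apply: (big_morph f (@ring_homD _ _ f)); exact: ring_hom0. Qed.

Lemma ring_hom_ideal0 l (P : 'I_l -> A) a :
  (forall j, f (P j) = 0) -> in_ideal P a -> f a = 0.
Proof.
move=> fP [q ->]; rewrite ring_hom_sum big1 // => j _.
by rewrite ring_homM fP cmulr0.
Qed.

End RingHom.

Section Ideal.
Variables (A : cring) (l : nat) (P : 'I_l -> A).
Add Ring A_ring : (cring_theory A).

Lemma in_ideal0 : in_ideal P 0.
Proof. by exists (fun _ => 0); rewrite big1 // => i _; rewrite cmul0r. Qed.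

Lemma in_idealD a b : in_ideal P a -> in_ideal P b -> in_ideal P (a + b).
Proof.
move=> [q ->] [r ->]; exists (fun i => q i + r i); rewrite -big_split /=.
by apply: eq_bigr => i _; rewrite cmulDl.
Qed.

Lemma in_idealMl c a : in_ideal P a -> in_ideal P (c * a).
Proof.
move=> [q ->]; exists (fun i => c * q i); rewrite big_distrr /=.
by apply: eq_bigr => i _; rewrite cmulA.
Qed.

Lemma in_ideal_gen j : in_ideal P (P j).
Proof.
exists (fun i => if i == j then 1 else 0).
rewrite (bigD1 j) //= eqxx cmul1r big1 ?caddr0 // => i /negPf->.
by rewrite cmul0r.
Qed.

Definition congruent (a b : A) : Prop := in_ideal P (a + - b).

Lemma congruent_refl a : congruent a a.
Proof. by rewrite /congruent caddrN; exact: in_ideal0. Qed.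

Lemma congruent_sym a b : congruent a b -> congruent b a.
Proof.
by move/(in_idealMl (copp cone)); rewrite /congruent; congr in_ideal; ring.
Qed.

Lemma congruent_trans b a c : congruent a b -> congruent b c -> congruent a c.
Proof.
move=> ab bc; move: (in_idealD ab bc).
by rewrite /congruent; congr in_ideal; ring.
Qed.

Lemma congruentD a a' b b' :
  congruent a a' -> congruent b b' -> congruent (a + b) (a' + b').
Proof.
move=> aa bb; move: (in_idealD aa bb).
by rewrite /congruent; congr in_ideal; ring.
Qed.

Lemma congruentM a a' b b' :
  congruent a a' -> congruent b b' -> congruent (a * b) (a' * b').
Proof.
move=> /(in_idealMl b) aa /(in_idealMl a') bb; move: (in_idealD aa bb).
by rewrite /congruent; congr in_ideal; ring.
Qed.

Lemma congruentN a a' : congruent a a' -> congruent (- a) (- a').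
Proof.
by move/(in_idealMl (copp cone)); rewrite /congruent; congr in_ideal; ring.
Qed.

(** * Quotient rings *)

(** Residue classes are predicates, equal as soon as they are equivalent. *)
Definition quot : Type := {S : A -> Prop | exists a, S = congruent a}.

Definition quot_class (a : A) : quot :=
  exist _ (congruent a) (ex_intro _ a erefl).

Lemma quot_class_surj : surj quot_class.
Proof.
move=> [S [a Sa]]; exists a; subst S; congr exist; exact: proof_irrelevance.
Qed.

Lemma quot_class_eq a b : quot_class a = quot_class b <-> congruent a b.
Proof.
split=> [/(congr1 (@proj1_sig _ _)) /= -> | ab]; first exact: congruent_refl.
have e : congruent a = congruent b.
  apply: functional_extensionality => c; apply: propositional_extensionality.
  split; last exact: congruent_trans.
  by apply: congruent_trans; exact: congruent_sym.
rewrite /quot_class; move: (ex_intro _ a _) (ex_intro _ b _); rewrite e => h h'.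
congr exist; exact: proof_irrelevance.
Qed.

Section Lift.
Variable UC : unique_choice.

(** The universal property of the set quotient: the common value of g on a class
    is unique, so a mere representative suffices to extract it. *)
Lemma quot_lift (X : Type) (g : A -> X) :
  (forall a b, congruent a b -> g a = g b) ->
  {h : quot -> X | forall a, h (quot_class a) = g a}.
Proof.
move=> gP.
have val q : {x | exists2 a, quot_class a = q & g a = x}.
  apply: UC; have [a <-] := quot_class_surj q.
  exists (g a); split=> [|x [b /quot_class_eq ba <-]]; first by exists a.
  by apply: gP; apply: congruent_sym.
exists (fun q => proj1_sig (val q)) => a.
by case: (val _) => x /= [b /quot_class_eq ba <-]; apply: gP.
Qed.

Lemma quot_lift2 (op : A -> A -> A) :
  (forall a a' b b', congruent a a' -> congruent b b' ->
     congruent (op a b) (op a' b')) ->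
  {h : quot -> quot -> quot |
    forall a b, h (quot_class a) (quot_class b) = quot_class (op a b)}.
Proof.
move=> opP.
have [|h hE] := @quot_lift (quot -> quot)
  (fun a => proj1_sig (@quot_lift quot (fun b => quot_class (op a b))
     (fun b b' bb => (quot_class_eq _ _).2 (opP _ _ _ _ (congruent_refl a) bb)))).
  move=> a a' aa; apply: functional_extensionality => q.
  case: quot_lift => h hE; case: quot_lift => h' hE' /=.
  have [b <-] := quot_class_surj q; rewrite hE hE'.
  by apply/quot_class_eq/opP => //; exact: congruent_refl.
by exists h => a b; rewrite hE; case: quot_lift => h' /= ->.
Qed.

Definition quot_add := proj1_sig (quot_lift2 congruentD).
Definition quot_mul := proj1_sig (quot_lift2 congruentM).
Definition quot_opp := proj1_sig (quot_lift
  (fun a b ab => (quot_class_eq (- a) (- b)).2 (congruentN ab))).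

Lemma quot_addE a b :
  quot_add (quot_class a) (quot_class b) = quot_class (a + b).
Proof. exact: proj2_sig (quot_lift2 congruentD) a b. Qed.

Lemma quot_mulE a b :
  quot_mul (quot_class a) (quot_class b) = quot_class (a * b).
Proof. exact: proj2_sig (quot_lift2 congruentM) a b. Qed.

Lemma quot_oppE a : quot_opp (quot_class a) = quot_class (- a).
Proof. by rewrite /quot_opp; case: quot_lift => h /= ->. Qed.

Lemma quot_ring_theory :
  ring_theory (quot_class 0) (quot_class 1) quot_add quot_mul
    (fun x y => quot_add x (quot_opp y)) quot_opp eq.
Proof.
split=> //; repeat (move=> q; have [? <-] := quot_class_surj q; clear q);
  rewrite ?(quot_oppE, quot_addE, quot_mulE); congr quot_class; ring.
Qed.

Definition quot_ring : cring := CRing quot_ring_theory.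

Definition quot_proj : ring_hom A quot_ring :=
  @RingHom A quot_ring quot_class erefl
    (fun a b => esym (quot_addE a b)) (fun a b => esym (quot_mulE a b)).

Lemma quot_proj_eq0 a : quot_proj a = 0 <-> in_ideal P a.
Proof.
by rewrite [quot_proj a = 0]quot_class_eq /congruent coppr0 caddr0.
Qed.

Lemma quot_hom (B : cring) (f : ring_hom A B) :
  (forall j, f (P j) = 0) ->
  {g : ring_hom quot_ring B | forall a, g (quot_proj a) = f a}.
Proof.
move=> fP.
have [|g gE] := @quot_lift B f.
  move=> a b /(ring_hom_ideal0 fP); rewrite ring_homD ring_homN => e.
  by apply: (@caddI _ (- f b)); rewrite caddNr caddC.
have gD (x y : quot_ring) : g (x + y) = g x + g y.
  have [a <-] := quot_class_surj x; have [b <-] := quot_class_surj y.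
  by rewrite /= quot_addE !gE ring_homD.
have gM (x y : quot_ring) : g (x * y) = g x * g y.
  have [a <-] := quot_class_surj x; have [b <-] := quot_class_surj y.
  by rewrite /= quot_mulE !gE ring_homM.
have g1 : g (1 : quot_ring) = 1 by rewrite gE ring_hom1.
by exists (RingHom g1 gD gM).
Qed.

End Lift.
End Ideal.

(** * Polynomials and their evaluation *)

Local Notation "c %:P" := (polyC_hom _ c) (at level 2, format "c %:P").

#[local] Arguments coef {R} p k : simpl never.

Section Polynomials.
Variable A : cring.

Program Definition polyX : poly_ring A :=
  exist _ (fun k => if k == 1%N then 1 else 0) _.
Next Obligation. by exists 2 => -[|[|k]]. Qed.

Lemma coef_polyD (p q : poly_ring A) k : coef (p + q) k = coef p k + coef q k.
Proof. by []. Qed.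

Lemma coef_polyN (p : poly_ring A) k : coef (- p) k = - coef p k.
Proof. by []. Qed.

Lemma coef_polyCM a (p : poly_ring A) k : coef (a%:P * p) k = a * coef p k.
Proof. exact: polyC_mul. Qed.

Lemma coef_polyXM (p : poly_ring A) k :
  coef (polyX * p) k = if k is k'.+1 then coef p k' else 0.
Proof.
rewrite coef_mulE big_ord_recl /= cmul0r cadd0r.
case: k => [|k]; first by rewrite big_ord0.
rewrite big_ord_recl /= cmul1r subn1 big1 ?caddr0 // => i _.
by rewrite cmul0r.
Qed.

(** Horner's scheme as an induction principle; it reduces the multiplicativity of
    evaluation to multiplication by a constant and by the variable. *)
Lemma poly_horner_ind (Q : poly_ring A -> Prop) :
  Q 0 -> (forall a p, Q p -> Q (a%:P + polyX * p)) -> forall p, Q p.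
Proof.
move=> Q0 QH [c [d]]; elim: d => [|d IHd] in c * => hc.
  rewrite (_ : exist _ c _ = (0 : poly_ring A)) //.
  by apply: poly_ext => -[|k]; exact: hc.
pose p : poly_ring A :=
  exist _ (fun k => c k.+1) (ex_intro _ d (fun k => hc k.+1)).
rewrite (_ : exist _ c _ = ((c 0%N)%:P + polyX * p : poly_ring A)).
  exact/QH/IHd.
apply: poly_ext => -[|k]; rewrite coef_polyD coef_polyXM /= ?caddr0 //.
by rewrite cadd0r.
Qed.

Section Evaluation.
Variables (UC : unique_choice) (B : cring) (f : ring_hom A B) (y : B).
Add Ring B_ring : (cring_theory B).

Let partial_value (p : poly_ring A) d : B :=
  \csum_(k < d) (f (coef p k) * iter k (cmul y) 1).

Let bound (p : poly_ring A) d := forall k, d <= k -> coef p k = 0.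

Let bounded p : exists d, bound p d.
Proof. exact: proj2_sig p. Qed.

Let partial_value_widen p d e :
  bound p d -> d <= e -> partial_value p e = partial_value p d.
Proof.
move=> pd /subnKC <-; rewrite /partial_value big_split_ord /=.
rewrite [X in _ + X]big1 ?caddr0 // => i _.
by rewrite pd ?leq_addr // ring_hom0 cmul0r.
Qed.

(* A degree bound is only known to exist, but the sum up to it does not depend on
   the bound. *)
Let value_exists p :
  exists! r, exists d, bound p d /\ partial_value p d = r.
Proof.
have [d pd] := bounded p.
exists (partial_value p d); split=> [|r [e [pe <-]]]; first by exists d.
rewrite -(partial_value_widen pd (leq_maxl d e)).
by rewrite (partial_value_widen pe (leq_maxr d e)).
Qed.

Let value p : B := proj1_sig (UC (value_exists p)).

Let valueE p d : bound p d -> value p = partial_value p d.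
Proof.
move=> pd; rewrite /value; case: UC => r /= [e [pe <-]].
rewrite -(partial_value_widen pe (leq_maxl e d)).
by rewrite (partial_value_widen pd (leq_maxr e d)).
Qed.

Let valueD p q : value (p + q) = value p + value q.
Proof.
have [d pd] := bounded p; have [e qe] := bounded q.
have pm : bound p (maxn d e) by move=> k; rewrite geq_max => /andP[/pd].
have qm : bound q (maxn d e) by move=> k; rewrite geq_max => /andP[_ /qe].
rewrite (valueE pm) (valueE qm) (@valueE _ (maxn d e)); last first.
  by move=> k mk; rewrite coef_polyD pm ?qm ?cadd0r.
rewrite -big_split /=; apply: eq_bigr => i _.
by rewrite coef_polyD ring_homD cmulDl.
Qed.

Let value_polyCM a p : value (a%:P * p) = f a * value p.
Proof.
have [d pd] := bounded p.
rewrite (valueE pd) (@valueE _ d); last first.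
  by move=> k dk; rewrite coef_polyCM pd ?cmulr0.
rewrite /partial_value big_distrr /=; apply: eq_bigr => i _.
by rewrite coef_polyCM ring_homM cmulA.
Qed.

Let value_polyXM p : value (polyX * p) = y * value p.
Proof.
have [d pd] := bounded p.
rewrite (valueE pd) (@valueE _ d.+1); last first.
  by move=> [|k] dk; rewrite coef_polyXM // pd.
rewrite /partial_value big_ord_recl coef_polyXM ring_hom0 cmul0r cadd0r.
rewrite big_distrr /=; apply: eq_bigr => i _.
by rewrite coef_polyXM /= add0n; ring.
Qed.

Let value1 : value 1 = 1.
Proof.
rewrite (@valueE _ 1%N) => [|[]//].
by rewrite /partial_value big_ord_recl big_ord0 /= ring_hom1 cmul1r caddr0.
Qed.

Let valueM p q : value (p * q) = value p * value q.
Proof.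
elim/poly_horner_ind: p => [|a p IHp].
  rewrite cmul0r (@valueE _ 0%N); last by case.
  by rewrite /partial_value big_ord0 cmul0r.
rewrite cmulDl -cmulA !valueD value_polyCM !value_polyXM IHp.
rewrite -[a%:P]cmulr1 value_polyCM value1; ring.
Qed.

Lemma poly_eval :
  {g : ring_hom (poly_ring A) B |
    (forall a, g a%:P = f a) /\ g polyX = y}.
Proof.
have valueC a : value a%:P = f a.
  by rewrite -[a%:P]cmulr1 value_polyCM value1 cmulr1.
have valueX : value polyX = y.
  by rewrite -[polyX]cmulr1 value_polyXM value1 cmulr1.
by exists (RingHom value1 valueD valueM).
Qed.

End Evaluation.
End Polynomials.

Section Multivariate.
Variable R : cring.

(** The outermost polynomial variable has index 0, so that a point of R^(n+1)
    splits as its head, the value of that variable, and its tail. *)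
Fixpoint mvar (n : nat) : 'I_n -> mpoly_alg R n :=
  match n return 'I_n -> mpoly_alg R n with
  | 0 => fun _ => 0
  | n'.+1 => fun i =>
      if unlift ord0 i is Some j then (mvar j)%:P else polyX _
  end.

Lemma mpoly_ind n (Q : mpoly_alg R n -> Prop) :
  (forall r, Q (alg_map _ r)) -> (forall k, Q (mvar k)) ->
  (forall p q, Q p -> Q q -> Q (p + q)) ->
  (forall p q, Q p -> Q q -> Q (p * q)) -> forall p, Q p.
Proof.
elim: n => [|n IHn] in Q * => QC QX QD QM; first exact: QC.
have Qconst a : Q a%:P.
  apply: (IHn (fun a => Q a%:P)) => [r|k|p q Qp Qq|p q Qp Qq].
  - exact: QC.
  - by have := QX (lift ord0 k); rewrite /= liftK.
  - by rewrite (ring_homD (polyC_hom _)); exact: QD.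
  - by rewrite (ring_homM (polyC_hom _)); exact: QM.
apply: poly_horner_ind => [|a p Qp]; first exact: (Qconst 0).
by apply: QD => //; apply: QM => //; have := QX ord0; rewrite /= unlift_none.
Qed.

Lemma mpoly_hom_ext n (B : algebra R) (f g : alg_hom (mpoly_alg R n) B) :
  (forall k, f (mvar k) = g (mvar k)) -> f =1 g.
Proof.
move=> fg p; elim/mpoly_ind: p => [r|k|p q fp fq|p q fp fq].
- by rewrite !alg_homC.
- exact: fg.
- by rewrite !ring_homD fp fq.
- by rewrite !ring_homM fp fq.
Qed.

Lemma mpoly_eval (UC : unique_choice) n (B : algebra R) (v : 'I_n -> B) :
  {f : alg_hom (mpoly_alg R n) B | forall k, f (mvar k) = v k}.
Proof.
elim: n => [|n IHn] in v *.
  by exists (@AlgHom R (self_alg R) B (alg_map B) (fun _ => erefl)) => -[].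
have [f fE] := IHn (fun k => v (lift ord0 k)).
have [g [gC gX]] := poly_eval UC f (v ord0).
have gA r : g (alg_map (mpoly_alg R n.+1) r) = alg_map B r.
  by rewrite /= gC alg_homC.
exists (AlgHom gA) => k /=.
by case: unliftP => [j|] ->; rewrite ?gC ?gX.
Qed.

End Multivariate.

(** * Linear algebra over the base ring *)

Section Modules.
Variable R : cring.

Lemma madd_cancel (M : module R) (x y z : M) : madd x y = madd x z -> y = z.
Proof.
by move=> e; rewrite -[y]madd0r -(maddNr x) -maddA e maddA maddNr madd0r.
Qed.

Lemma linear_map0 (M N : module R) (f : linear_map M N) : f mzero = mzero.
Proof.
apply: (@madd_cancel _ (f mzero)).
by rewrite -linear_mapD madd0r maddC madd0r.
Qed.

Lemma linear_mapN (M N : module R) (f : linear_map M N) x :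
  f (mopp x) = mopp (f x).
Proof.
apply: (@madd_cancel _ (f x)).
by rewrite -linear_mapD ![madd _ (mopp _)]maddC !maddNr linear_map0.
Qed.

Lemma linear_map_eq (M N : module R) (f : linear_map M N) x y :
  f (madd x (mopp y)) = mzero -> f x = f y.
Proof.
rewrite linear_mapD linear_mapN => e; apply: (@madd_cancel _ (mopp (f y))).
by rewrite maddC e maddNr.
Qed.

Lemma linear_inj (M N : module R) (f : linear_map M N) :
  (forall x, f x = mzero -> x = mzero) -> injective f.
Proof.
move=> f0 x y fxy; apply: (@madd_cancel _ (mopp y)).
rewrite maddNr maddC; apply: f0.
by rewrite linear_mapD linear_mapN fxy maddC maddNr.
Qed.

Lemma bijective_linear_iso (UC : unique_choice) (M N : module R)
  (f : linear_map M N) : injective f -> surj f -> linear_iso N M.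
Proof.
move=> f_inj f_surj.
have inv y : {x | f x = y}.
  apply: UC; have [x fx] := f_surj y; exists x; split=> // x' fx'.
  by apply: f_inj; rewrite fx.
pose g y := proj1_sig (inv y).
have gK y : f (g y) = y by exact: proj2_sig (inv y).
have gD x y : g (madd x y) = madd (g x) (g y).
  by apply: f_inj; rewrite linear_mapD !gK.
have gZ a x : g (mscale a x) = mscale a (g x).
  by apply: f_inj; rewrite linear_mapZ !gK.
by apply: (@LinearIso _ _ _ (LinearMap gD gZ) f) => [y|x] /=; [|apply: f_inj].
Qed.

(** The universal property of the cokernel: the value at z is unique because two
    lifts of z differ by an element of the image of f. *)
Lemma cokernel_factor (UC : unique_choice) (L M N K : module R)
  (f : linear_map L M) (p : linear_map M N) (g : linear_map M K) :
  is_cokernel f p -> (forall x, g (f x) = mzero) ->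
  exists h : linear_map N K, forall y, h (p y) = g y.
Proof.
move=> [p_surj p_ker] gf.
have gp y y' : p y = p y' -> g y = g y'.
  move=> e; apply: linear_map_eq.
  have [|x <-] := (p_ker (madd y (mopp y'))).1; last exact: gf.
  by rewrite linear_mapD linear_mapN e maddC maddNr.
have val z : {r | exists2 y, p y = z & g y = r}.
  apply: UC; have [y <-] := p_surj z.
  by exists (g y); split=> [|r [y' /gp e <-]]; first by exists y.
pose h z := proj1_sig (val z).
have hp y : h (p y) = g y.
  by rewrite /h; case: (val (p y)) => r /= [y' /gp e <-].
have hD x y : h (madd x y) = madd (h x) (h y).
  have [u <-] := p_surj x; have [v <-] := p_surj y.
  by rewrite -linear_mapD !hp linear_mapD.
have hZ a x : h (mscale a x) = mscale a (h x).
  by have [u <-] := p_surj x; rewrite -linear_mapZ !hp linear_mapZ.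
by exists (LinearMap hD hZ).
Qed.

Definition basis_vector n (k : 'I_n) : 'I_n -> R :=
  fun i => if i == k then 1 else 0.

Definition pairing n (c v : 'I_n -> R) : R := \csum_(k < n) (c k * v k).

Lemma pairingC n (c v : 'I_n -> R) : pairing c v = pairing v c.
Proof. by apply: eq_bigr => k _; rewrite cmulC. Qed.

Lemma pairing_basis n (c : 'I_n -> R) k : pairing c (basis_vector k) = c k.
Proof.
rewrite /pairing (bigD1 k) //= /basis_vector eqxx cmulr1 big1 ?caddr0 //.
by move=> i /negPf->; rewrite cmulr0.
Qed.

Lemma pairing0 n (c : 'I_n -> R) : pairing c (fun _ => 0) = 0.
Proof. by apply: big1 => k _; rewrite cmulr0. Qed.

Lemma pairingD n (c v w : 'I_n -> R) :
  pairing c (fun k => v k + w k) = pairing c v + pairing c w.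
Proof.
by rewrite -big_split; apply: eq_bigr => k _; rewrite cmulDr.
Qed.

Lemma pairingZ n (c : 'I_n -> R) a v :
  pairing c (fun k => a * v k) = a * pairing c v.
Proof.
rewrite /pairing big_distrr; apply: eq_bigr => k _ /=.
by rewrite !cmulA (cmulC a).
Qed.

Definition pairing_map n (c : 'I_n -> R) :
    linear_map (free_mod R n) (self_mod R) :=
  @LinearMap R (free_mod R n) (self_mod R) (pairing c) (pairingD c) (pairingZ c).

Lemma free_linear_form n (g : linear_map (free_mod R n) (self_mod R)) v :
  g v = pairing (fun k => g (basis_vector k)) v.
Proof.
pose comb := \big[@madd R (free_mod R n)/mzero]_(k < n)
  mscale (v k) (basis_vector k : free_mod R n).
have vE : v = comb.
  apply: functional_extensionality => i.
  rewrite /comb (big_morph (fun u : free_mod R n => u i)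
    (id1 := 0) (op1 := @cadd R)) //.
  rewrite -[LHS](pairing_basis v) /pairing; apply: eq_bigr => k _ /=.
  by rewrite /basis_vector eq_sym.
rewrite {1}vE (big_morph g (linear_mapD g) (linear_map0 g)).
by apply: eq_bigr => k _; rewrite linear_mapZ /= cmulC.
Qed.

End Modules.

(** * Polynomial functions on zero loci *)

Section ZeroLocus.
Variables (UC : unique_choice) (R : cring).

Definition meval n (B : algebra R) (v : 'I_n -> B) : alg_hom (mpoly_alg R n) B :=
  proj1_sig (mpoly_eval UC v).

Lemma meval_var n (B : algebra R) (v : 'I_n -> B) k : meval v (mvar R k) = v k.
Proof. exact: (proj2_sig (mpoly_eval UC v)). Qed.

Definition point_eval n (v : 'I_n -> R) : ring_hom (mpoly_alg R n) R :=
  @meval n (self_alg R) v.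

Lemma point_eval_const n (v : 'I_n -> R) r : point_eval v (alg_map _ r) = r.
Proof. by rewrite /point_eval alg_homC. Qed.

Lemma point_eval_var n (v : 'I_n -> R) k : point_eval v (mvar R k) = v k.
Proof. by rewrite /point_eval meval_var. Qed.

Lemma point_eval_unique n (v : 'I_n -> R) (f : ring_hom (mpoly_alg R n) R) :
  (forall r, f (alg_map _ r) = r) -> (forall k, f (mvar R k) = v k) ->
  f =1 point_eval v.
Proof.
move=> fC fX; pose f' := @AlgHom R (mpoly_alg R n) (self_alg R) f fC.
apply: (@mpoly_hom_ext _ _ _ f' (@meval n (self_alg R) v)) => k.
by rewrite meval_var -fX.
Qed.

Definition zero_locus n l (P : 'I_l -> mpoly_alg R n) (v : 'I_n -> R) : Prop :=
  forall j, point_eval v (P j) = 0.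

Variables (R_duality : duality R) (n l : nat) (P : 'I_l -> mpoly_alg R n).

Definition coord_alg : algebra R :=
  Algebra (ring_comp (quot_proj P UC) (alg_map (mpoly_alg R n))).

Definition coord_proj : alg_hom (mpoly_alg R n) coord_alg :=
  @AlgHom R (mpoly_alg R n) coord_alg (quot_proj P UC) (fun _ => erefl).

Lemma coord_alg_fp : fin_presented_alg coord_alg.
Proof.
exists n, l, P, coord_proj; split=> [q|p]; last exact: quot_proj_eq0.
exact: quot_class_surj.
Qed.

Definition spec_coords (x : Spec coord_alg) (k : 'I_n) : R :=
  x (coord_proj (mvar R k)).

Lemma spec_eval_proj (x : Spec coord_alg) p :
  x (coord_proj p) = point_eval (spec_coords x) p.
Proof.
apply: (point_eval_unique (f := ring_comp x coord_proj)) => // r.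
exact: (alg_homC x r).
Qed.

Lemma spec_coords_zero (x : Spec coord_alg) : zero_locus P (spec_coords x).
Proof.
move=> j; rewrite -spec_eval_proj -[RHS](ring_hom0 x); congr (x _).
exact/quot_proj_eq0/in_ideal_gen.
Qed.

Lemma zero_locus_point v : zero_locus P v -> exists x, spec_coords x = v.
Proof.
move=> Pv; have [g gE] := quot_hom UC Pv.
have gC r : g (alg_map coord_alg r) = alg_map (self_alg R) r.
  by rewrite gE /= point_eval_const.
exists (@AlgHom R coord_alg (self_alg R) g gC).
apply: functional_extensionality => k.
by rewrite /spec_coords /= gE point_eval_var.
Qed.

(** Injectivity of the duality map, read on zeros in R^n: a Nullstellensatz
    without radical. *)
Lemma vanishing_in_ideal p :
  (forall v, zero_locus P v -> point_eval v p = 0) -> in_ideal P p.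
Proof.
move=> p0; apply/(quot_proj_eq0 P UC).
apply: (bij_inj (R_duality coord_alg_fp)).
apply: functional_extensionality => x; rewrite /Spec_eval.
rewrite [LHS](spec_eval_proj x) p0; last exact: spec_coords_zero.
by rewrite ring_hom0.
Qed.

(** Surjectivity of the duality map, read on zeros in R^n.  The function is given
    by its graph, so that it need not be defined outside the zero locus. *)
Lemma function_polynomial (F : ('I_n -> R) -> R -> Prop) :
  (forall v, zero_locus P v -> exists! r, F v r) ->
  exists p, forall v, zero_locus P v -> F v (point_eval v p).
Proof.
move=> Ffun.
pose h (x : Spec coord_alg) := UC (Ffun _ (spec_coords_zero x)).
have [sec _ secK] := R_duality coord_alg_fp.
have [p pE] := quot_class_surj (sec (fun x => proj1_sig (h x))).
exists p => v /zero_locus_point[x <-].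
rewrite -spec_eval_proj [coord_proj p]pE.
by rewrite -[x _]/(Spec_eval _ x) secK; exact: proj2_sig (h x).
Qed.

End ZeroLocus.

(** * Linear parts of polynomials *)

Section LinearPart.
Variables (UC : unique_choice) (R : cring).
Add Ring R_ring : (cring_theory R).

Local Notation ev := (point_eval UC).

Definition linear_form n (c : 'I_n -> R) : mpoly_alg R n :=
  \csum_(k < n) (alg_map _ (c k) * mvar R k).

Lemma point_eval_linear n (v c : 'I_n -> R) :
  ev v (linear_form c) = pairing c v.
Proof.
rewrite ring_hom_sum; apply: eq_bigr => k _.
by rewrite ring_homM point_eval_const point_eval_var.
Qed.

(** The substitution of TX for X, with values in R[X][T]; the coefficient of T^d
    is the homogeneous part of degree d. *)
Definition scaling n : ring_hom (mpoly_alg R n) (poly_ring (mpoly_alg R n)) :=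
  @meval UC R n (mpoly_alg R n.+1) (fun k => polyX _ * (mvar R k)%:P).

Lemma scaling_const n r : scaling n (alg_map _ r) = (alg_map _ r)%:P.
Proof. by rewrite /scaling alg_homC. Qed.

Lemma scaling_var n k : scaling n (mvar R k) = polyX _ * (mvar R k)%:P.
Proof. by rewrite /scaling meval_var. Qed.

(** The linear part of p evaluated at v, which is also the derivative of p at the
    origin along v; [directionalM] is the Leibniz rule. *)
Definition directional n (v : 'I_n -> R) (p : mpoly_alg R n) : R :=
  ev v (coef (scaling n p) 1).

Section Cylinder.
Variables (n : nat) (w : 'I_n.+1 -> R).

Let tail (k : 'I_n) := w (lift ord0 k).

Local Notation ev1 :=
  (@point_eval UC R n.+1 w : ring_hom (poly_ring (mpoly_alg R n)) R).

Lemma point_eval_polyC p : ev1 p%:P = ev tail p.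
Proof.
apply: (point_eval_unique UC (f := ring_comp ev1 (polyC_hom _))) => [r|k] /=.
  exact: (@point_eval_const UC R n.+1).
by have := point_eval_var UC w (lift ord0 k); rewrite /= liftK.
Qed.

Lemma point_eval_polyX : ev1 (polyX _) = w ord0.
Proof. by have := point_eval_var UC w ord0; rewrite /= unlift_none. Qed.

Lemma point_eval_scaling p : ev1 (scaling n p) = ev (fun k => w ord0 * tail k) p.
Proof.
apply: (point_eval_unique UC (f := ring_comp ev1 (scaling n))) => [r|k] /=.
  by rewrite scaling_const point_eval_polyC point_eval_const.
rewrite scaling_var ring_homM point_eval_polyX point_eval_polyC.
by rewrite point_eval_var.
Qed.

End Cylinder.

Lemma coef0_scaling n (v : 'I_n -> R) p :
  ev v (coef (scaling n p) 0) = ev (fun _ => 0) p.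
Proof.
elim/mpoly_ind: p => [r|k|p q ep eq|p q ep eq].
- by rewrite scaling_const [RHS]point_eval_const /= point_eval_const.
- by rewrite scaling_var point_eval_var coef_polyXM ring_hom0.
- by rewrite !ring_homD ep eq.
- rewrite !ring_homM coef_mulE big_ord_recl big_ord0 caddr0.
  by rewrite ring_homM ep eq.
Qed.

Lemma directional_const n (v : 'I_n -> R) r : directional v (alg_map _ r) = 0.
Proof. by rewrite /directional scaling_const ring_hom0. Qed.

Lemma directional_var n (v : 'I_n -> R) k : directional v (mvar R k) = v k.
Proof. by rewrite /directional scaling_var coef_polyXM point_eval_var. Qed.

Lemma directionalD n (v : 'I_n -> R) p q :
  directional v (p + q) = directional v p + directional v q.
Proof. by rewrite /directional ring_homD coef_polyD ring_homD. Qed.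

Lemma directionalM n (v : 'I_n -> R) p q :
  directional v (p * q) =
    ev (fun _ => 0) p * directional v q + directional v p * ev (fun _ => 0) q.
Proof.
rewrite /directional ring_homM coef_mulE !big_ord_recl big_ord0 caddr0.
by rewrite ring_homD !ring_homM !coef0_scaling.
Qed.

(** Both sides are derivations at the origin and agree on the variables. *)
Lemma directional_linear n (v : 'I_n -> R) p :
  directional v p = pairing (fun k => directional (basis_vector R k) p) v.
Proof.
elim/mpoly_ind: p => [r|k|p q ep eq|p q ep eq].
- rewrite directional_const /pairing big1 // => k _.
  by rewrite directional_const cmul0r.
- rewrite directional_var /pairing (bigD1 k) //= directional_var.
  rewrite /basis_vector eqxx.
  rewrite cmul1r big1 ?caddr0 // => i /negPf ik.
  by rewrite directional_var eq_sym ik cmul0r.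
- rewrite directionalD ep eq /pairing -big_split /=; apply: eq_bigr => k _.
  by rewrite directionalD cmulDl.
- rewrite directionalM ep eq /pairing big_distrr big_distrl -big_split /=.
  by apply: eq_bigr => k _; rewrite directionalM; ring.
Qed.

Lemma directional_linear_form n (v c : 'I_n -> R) :
  directional v (linear_form c) = pairing c v.
Proof.
rewrite /linear_form (big_morph (directional v) (directionalD v) (id1 := 0)).
  apply: eq_bigr => k _.
  rewrite directionalM directional_const directional_var.
  by rewrite point_eval_const cmul0r caddr0.
by rewrite -(ring_hom0 (alg_map _)) directional_const.
Qed.

End LinearPart.

(** * Linear forms on the kernel of a matrix *)

Section Kernel.
Variables (UC : unique_choice) (R : cring) (R_duality : duality R).
Variables (n m : nat) (L : module R).
Variables (f : linear_map (free_mod R n) (free_mod R m)).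
Variables (i : linear_map L (free_mod R n)) (ker_fi : is_kernel f i).

Local Notation ev := (point_eval UC).

Let row (j : 'I_m) (k : 'I_n) : R := f (basis_vector R k) j.

Lemma matrix_entries v j : f v j = pairing (row j) v.
Proof.
have jD (u w : free_mod R m) : madd u w j = u j + w j by [].
have fD x y : f (madd x y) j = f x j + f y j by rewrite linear_mapD.
have fZ a x : f (mscale a x) j = a * f x j by rewrite linear_mapZ.
exact: (free_linear_form (@LinearMap R (free_mod R n) (self_mod R)
  (fun x => f x j) fD fZ)).
Qed.

Let row_forms j : mpoly_alg R n := linear_form (row j).

Lemma zero_locus_kernel v :
  zero_locus UC row_forms v <-> exists x, i x = v.
Proof.
rewrite -(ker_fi.2 v); split=> [fv|fv j].
  apply: functional_extensionality => j.
  by rewrite matrix_entries -(point_eval_linear UC); exact: fv.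
by rewrite point_eval_linear -matrix_entries fv.
Qed.

(** The form is a combination of the l_j with polynomial coefficients q_j.  Since
    the l_j vanish at the origin, by the Leibniz rule only the values q_j(0)
    contribute to its linear part. *)
Lemma kernel_annihilator (c : 'I_n -> R) :
  (forall x, pairing c (i x) = 0) ->
  exists d : 'I_m -> R, forall k, c k = pairing d (fun j => row j k).
Proof.
move=> ci0; have [v /zero_locus_kernel[x <-]|q cE] :=
    @vanishing_in_ideal UC R R_duality n m row_forms (linear_form c).
  by rewrite point_eval_linear.
exists (fun j => ev (fun _ => 0) (q j)) => k.
rewrite -[LHS]pairing_basis -(directional_linear_form UC) cE.
have D0 : directional UC (basis_vector R k) 0 = 0.
  by rewrite -(ring_hom0 (alg_map _)) directional_const.
rewrite (big_morph _ (directionalD UC _) D0); apply: eq_bigr => j _.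
rewrite directionalM directional_linear_form pairing_basis.
by rewrite point_eval_linear pairing0 cmulr0 caddr0.
Qed.

(** A form g on L is the function of a polynomial p, and p(TX) - T p(X) vanishes
    on the cylinder L x R because g is homogeneous.  By duality for the cylinder
    it lies in the ideal of the l_j; as these do not involve T, taking
    coefficients of T shows that the linear part of p agrees with p on L. *)
Lemma kernel_form_extends (g : linear_map L (self_mod R)) :
  exists c : 'I_n -> R, forall x, g x = pairing c (i x).
Proof.
have [v|p pE] := @function_polynomial UC R R_duality n m row_forms
    (fun v r => exists2 x, i x = v & g x = r).
  move=> /zero_locus_kernel[x <-].
  by exists (g x); split=> [|r [y /ker_fi.1 -> //]]; exists x.
have {}pE x : ev (i x) p = g x.
  have [|y /ker_fi.1 ->] := pE (i x); last by [].
  by apply/zero_locus_kernel; exists x.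
exists (fun k => directional UC (basis_vector R k) p) => x.
rewrite -directional_linear -pE.
(* The l_j as polynomials in X and T, constant in T: they cut out L x R. *)
pose A := mpoly_alg R n.
pose cyl_forms j : poly_ring A := (row_forms j)%:P.
have [w Pw|q] := @vanishing_in_ideal UC R R_duality n.+1 m cyl_forms
    (scaling UC R n p + - (polyX A * p%:P) : poly_ring A).
  have /zero_locus_kernel[y yE] :
      zero_locus UC row_forms (fun k => w (lift ord0 k)).
    by move=> j; rewrite -point_eval_polyC; exact: Pw.
  rewrite ring_homD ring_homN ring_homM point_eval_scaling point_eval_polyX.
  rewrite point_eval_polyC.
  have -> : (fun k => w ord0 * w (lift ord0 k)) = i (mscale (w ord0) y).
    by rewrite linear_mapZ yE.
  by rewrite -yE !pE linear_mapZ caddrN.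
(* The coefficient of T, then evaluation at a point of L. *)
move=> /(congr1 (fun s : poly_ring A => ev (i x) (coef s 1))).
rewrite coef_polyD coef_polyN coef_polyXM ring_homD ring_homN.
rewrite (big_morph (fun s : poly_ring A => coef s 1) (id1 := 0)
  (fun s t => coef_polyD s t 1)) // ring_hom_sum big1 => [|j _].
  move=> e; rewrite -[RHS]caddr0 -(caddNr (ev (i x) p)) caddA.
  by rewrite [_ + - _]e cadd0r.
rewrite cmulC coef_polyCM ring_homM.
have /zero_locus_kernel -> : exists y, i y = i x by exists x.
by rewrite cmul0r.
Qed.

End Kernel.

(** * Reflexivity *)

Section Bidual.
Variables (UC : unique_choice) (R : cring).

Definition form_eval (M : module R) (g : dual M) (x : M) : R :=
  (g : linear_map M (self_mod R)) x.

Definition bidual_point (M : module R) (x : M) : dual (dual M) :=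
  @LinearMap R (dual M) (self_mod R) (fun g => form_eval g x)
    (fun _ _ => erefl) (fun _ _ => erefl).

Program Definition bidual_map (M : module R) : linear_map M (dual (dual M)) :=
  @LinearMap R M (dual (dual M)) (@bidual_point M) _ _.
Next Obligation.
by apply: linear_ext => g; exact: (linear_mapD (g : linear_map M (self_mod R))).
Qed.
Next Obligation.
by apply: linear_ext => g; exact: (linear_mapZ (g : linear_map M (self_mod R))).
Qed.

Lemma bidual_mapE (M : module R) x (g : dual M) :
  form_eval (bidual_map M x) g = form_eval g x.
Proof. by []. Qed.

Hypothesis R_duality : duality R.

Section Copresented.
Variables (n m : nat) (M : module R).
Variables (f : linear_map (free_mod R n) (free_mod R m)).
Variables (i : linear_map M (free_mod R n)) (ker_fi : is_kernel f i).

(** With [pullback_map], the transpose of i, from R^n to the dual of M; it is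
    surjective by [kernel_form_extends]. *)
Definition pullback_form (c : 'I_n -> R) : linear_map M (self_mod R) :=
  @LinearMap R M (self_mod R) (fun x => pairing c (i x))
   (fun x y => etrans (congr1 (pairing c) (linear_mapD i x y)) (pairingD _ _ _))
   (fun a x => etrans (congr1 (pairing c) (linear_mapZ i a x)) (pairingZ _ _ _)).

Definition pullback_map : linear_map (free_mod R n) (dual M).
Proof.
apply: (@LinearMap R (free_mod R n) (dual M) pullback_form) => [c d|a c].
  by apply: linear_ext => x /=; rewrite pairingC pairingD -!(pairingC (i x)).
by apply: linear_ext => x /=; rewrite pairingC pairingZ -!(pairingC (i x)).
Defined.

(** Surjectivity: the point representing F has as coordinates the values of F on
    the coordinate forms.  It lies in M because each row of f pulls back to the
    zero form on M, on which F vanishes. *)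
Lemma copresented_reflexive : injective (bidual_map M) /\ surj (bidual_map M).
Proof.
split=> [x y exy|F].
  apply: ker_fi.1; apply: functional_extensionality => k.
  have := congr1 (fun F => form_eval F (pullback_map (basis_vector R k))) exy.
  rewrite !bidual_mapE /form_eval /=.
  by rewrite ![pairing (basis_vector R k) _]pairingC !pairing_basis.
pose FF : linear_map (dual M) (self_mod R) := F.
pose v k : R := FF (pullback_map (basis_vector R k)).
have Fv c : FF (pullback_map c) = pairing c v.
  pose G := @LinearMap R (free_mod R n) (self_mod R)
    (fun c => FF (pullback_map c)).
  have GD c' d : FF (pullback_map (madd c' d)) =
      madd (FF (pullback_map c')) (FF (pullback_map d)) by rewrite !linear_mapD.
  have GZ a d : FF (pullback_map (mscale a d)) = mscale a (FF (pullback_map d)).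
    by rewrite !linear_mapZ.
  by rewrite -[LHS]/(G GD GZ c) free_linear_form pairingC.
have [|x xv] := (ker_fi.2 v).1.
  apply: functional_extensionality => j; rewrite matrix_entries -Fv.
  rewrite [pullback_map _](_ : _ = dual_zero M) ?linear_map0 //.
  apply: linear_ext => x /=; rewrite -matrix_entries.
  by have -> : f (i x) = mzero by apply/ker_fi.2; exists x.
exists x; apply: linear_ext => g; rewrite -[LHS]/(form_eval g x) /form_eval.
have [c gE] := kernel_form_extends UC R_duality ker_fi g.
rewrite gE xv -Fv; congr (FF _); apply: linear_ext => y.
by rewrite gE.
Qed.

End Copresented.
Section Presented.
Variables (a b : nat) (M : module R).
Variables (f : linear_map (free_mod R a) (free_mod R b)).
Variables (p : linear_map (free_mod R b) M) (coker_fp : is_cokernel f p).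

Definition transpose : linear_map (free_mod R b) (free_mod R a).
Proof.
apply: (@LinearMap R (free_mod R b) (free_mod R a)
  (fun c j => pairing c (f (basis_vector R j)))) => [c d|r c].
  apply: functional_extensionality => j /=.
  by rewrite pairingC pairingD -!(pairingC (f _)).
apply: functional_extensionality => j /=.
by rewrite pairingC pairingZ -!(pairingC (f _)).
Defined.

Lemma pairing_transpose c v : pairing c (f v) = pairing (transpose c) v.
Proof.
have gD u w : pairing c (f (madd u w)) = pairing c (f u) + pairing c (f w).
  by rewrite linear_mapD pairingD.
have gZ r u : pairing c (f (mscale r u)) = r * pairing c (f u).
  by rewrite linear_mapZ pairingZ.
exact: (free_linear_form (@LinearMap R (free_mod R a) (self_mod R)
  (fun v => pairing c (f v)) gD gZ)).
Qed.

Definition generator_values : linear_map (dual M) (free_mod R b) :=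
  @LinearMap R (dual M) (free_mod R b)
    (fun g k => form_eval g (p (basis_vector R k)))
    (fun _ _ => erefl) (fun _ _ => erefl).

Lemma form_eval_generators (g : dual M) c :
  form_eval g (p c) = pairing (generator_values g) c.
Proof.
pose h : linear_map M (self_mod R) := g.
have gD u w : h (p (madd u w)) = madd (h (p u)) (h (p w)).
  by rewrite !linear_mapD.
have gZ r u : h (p (mscale r u)) = mscale r (h (p u)) by rewrite !linear_mapZ.
exact: (free_linear_form (@LinearMap R (free_mod R b) (self_mod R)
  (fun v => h (p v)) gD gZ)).
Qed.

(** Dualizing is left exact: a form on M is a form on R^b that vanishes on the
    image of f, that is, a vector killed by the transpose. *)
Lemma dual_kernel : is_kernel transpose generator_values.
Proof.
split=> [g h gh|c].
  apply: linear_ext => x; have [u <-] := coker_fp.1 x.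
  by rewrite -[LHS]/(form_eval g _) form_eval_generators gh -form_eval_generators.
split=> [fc0|[g <-]].
  have [|g gE] := cokernel_factor (g := pairing_map c) UC coker_fp.
    by move=> v /=; rewrite pairing_transpose fc0 pairingC pairing0.
  exists g; apply: functional_extensionality => k.
  by rewrite -[LHS]/(g (p _)) gE /= pairing_basis.
apply: functional_extensionality => j.
rewrite -[LHS]/(pairing _ _) -form_eval_generators.
have -> : p (f (basis_vector R j)) = mzero.
  by apply/coker_fp.2; exists (basis_vector R j).
exact: (linear_map0 (g : linear_map M (self_mod R))).
Qed.

(** The two facts about kernels, applied to the dual of M inside R^b: extension
    of forms gives surjectivity, and the annihilator gives injectivity. *)
Lemma presented_reflexive : injective (bidual_map M) /\ surj (bidual_map M).
Proof.
split=> [|F].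
  apply: linear_inj => x; have [c <-] := coker_fp.1 x => evc0.
  have [g|d cE] := kernel_annihilator UC R_duality dual_kernel (c := c).
    by rewrite pairingC -form_eval_generators -bidual_mapE evc0.
  apply/coker_fp.2; exists d; apply: functional_extensionality => k.
  rewrite cE matrix_entries pairingC; apply: eq_bigr => j _; congr cmul.
  by rewrite /= pairingC pairing_basis.
have [c FE] := kernel_form_extends UC R_duality dual_kernel F.
exists (p c); apply: linear_ext => g.
by rewrite FE -[LHS]/(form_eval g _) form_eval_generators pairingC.
Qed.

End Presented.
End Bidual.

Theorem corollary2p3p10
    (UC : unique_choice)
    (R : cring) (R_local : locality R) (R_duality : duality R)
    (R_choice : zariski_local_choice R)
    (M : module R) (M_fin : fin_presented M \/ fin_copresented M) :
  linear_iso (dual (dual M)) M.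
Proof.
have [M_inj M_surj] : injective (bidual_map M) /\ surj (bidual_map M).
  case: M_fin => [[a [b [f [p fp]]]] | [n [m [f [i fi]]]]].
    exact: presented_reflexive fp.
  exact: copresented_reflexive fi.
exact (@bijective_linear_iso R UC M (dual (dual M)) (bidual_map M) M_inj M_surj).
Qed.
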